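(* Let $Z$ be a finite bipartite graph embedded in the $2$-sphere $S^2$, with $4n$ vertices for some integer $n$. Suppose $Z$ is invariant under the antipodal involution $g$ of $S^2$, and that $g$ exchanges the two colors (black and white) of the vertices of $Z$. Then the number of perfect matchings of $Z$ equals the square of the number of perfect matchings of the quotient graph $Z/g$.
   Context: A perfect matching of a graph is a set of edges such that every vertex lies in exactly one of them. The quotient graph $Z/g$ is the graph (embedded in the real projective plane $S^2/g$) whose vertices are the $g$-orbits of vertices of $Z$ and whose edges are the $g$-orbits of edges of $Z$, with incidence induced from $Z$. *)

(* Defs.v *)
From HB Require Import structures.
From mathcomp Require Import all_boot all_order all_fingroup all_algebra.
From mathcomp Require Import all_classical all_reals all_analysis.

Set Implicit Arguments.
Unset Strict Implicit.
Unset Printing Implicit Defensive.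

Import Order.TTheory GRing.Theory Num.Theory.
Import numFieldNormedType.Exports.

(* Parallel edges are allowed, and an edge [e] with [#|ends e| = 1] is a loop. *)
Record graph := Graph {
  vertex : finType;
  edge : finType;
  ends : edge -> {set vertex};
  ends_card : forall e, 0 < #|ends e| <= 2 }.

Arguments ends {g} e.

Definition perfect_matching (Z : graph) (M : {set edge Z}) : bool :=
  [forall v : vertex Z, #|[set e in M | v \in ends e]| == 1].

Definition num_perfect_matchings (Z : graph) : nat :=
  #|[set M : {set edge Z} | perfect_matching M]|.

Definition bipartition (Z : graph) (black : vertex Z -> bool) : Prop :=
  forall e : edge Z, exists b w : vertex Z,
    [/\ ends e = [set b; w]%SET, black b & ~~ black w].

Record automorphism (Z : graph) := Automorphism {
  aut_vertex : {perm vertex Z};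
  aut_edge : {perm edge Z};
  aut_ends : forall e, ends (aut_edge e) = aut_vertex @: ends e }.

Section Quotient.
Variables (Z : graph) (g : automorphism Z).

Definition quotient_vertex : finType :=
  {A : {set vertex Z} | A \in porbits (aut_vertex g)}.

Definition quotient_edge : finType :=
  {A : {set edge Z} | A \in porbits (aut_edge g)}.

Definition quotient_ends (A : quotient_edge) : {set quotient_vertex} :=
  [set B : quotient_vertex |
    [exists e in val A, exists v in val B, v \in ends e]].

Lemma aut_ends_iter k (e : edge Z) :
  ends ((aut_edge g ^+ k)%g e) = (aut_vertex g ^+ k)%g @: ends e.
Proof.
elim: k => [|k IH].
  rewrite !expg0 perm1 -[LHS]imset_id.
  by apply: eq_imset => v; rewrite perm1.
rewrite !expgSr permM aut_ends IH -imset_comp.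
by apply: eq_imset => v; rewrite /= permM.
Qed.

Lemma quotient_ends_card (A : quotient_edge) : 0 < #|quotient_ends A| <= 2.
Proof.
have /imsetP[e _ Ae] := valP A.
have /andP[e_gt0 e_le2] := ends_card e.
apply/andP; split.
  case/card_gt0P: e_gt0 => v ve.
  have vP : porbit (aut_vertex g) v \in porbits (aut_vertex g).
    exact: imset_f.
  apply/card_gt0P; exists (exist _ (porbit (aut_vertex g) v) vP : quotient_vertex); rewrite inE.
  apply/existsP; exists e; rewrite Ae porbit_id /=.
  by apply/existsP; exists v; rewrite porbit_id.
rewrite -(card_imset _ val_inj); apply: leq_trans e_le2.
apply: leq_trans (leq_imset_card (porbit (aut_vertex g)) _).
apply/subset_leq_card/fintype.subsetP => _ /imsetP[B + ->].
rewrite inE => /exists_inP[f]; rewrite Ae => /porbitP[k ->].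
case/exists_inP => v vB; rewrite aut_ends_iter => /imsetP[u ue vE].
have /imsetP[w _ Bw] := valP B.
apply/imsetP; exists u => //.
move: vB; rewrite Bw -eq_porbit_mem => /eqP <-.
by apply/eqP; rewrite eq_porbit_mem vE; apply: mem_porbit.
Qed.

Definition quotient_graph : graph := Graph quotient_ends_card.

End Quotient.

Local Open Scope ring_scope.
Local Open Scope classical_set_scope.

(* The norm of ['rV[R]_3] is the maximum norm, hence the explicit squares. *)
Definition sphere2 (R : realType) : set 'rV[R]_3 :=
  [set x : 'rV[R]_3 | \sum_i x ord0 i ^+ 2 = 1].

(* [curve e] is only relevant on [0, 1]. Its values at 0 and 1 coincide
   exactly when [e] is a loop. *)
Record sphere_embedding (R : realType) (Z : graph) := SphereEmbedding {
  pos : vertex Z -> 'rV[R]_3;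
  curve : edge Z -> R -> 'rV[R]_3;
  pos_sphere : forall v, sphere2 (pos v);
  pos_inj : injective pos;
  curve_continuous : forall e, {within `[0, 1], continuous (curve e)};
  curve_sphere : forall e (t : R), `[0, 1] t -> sphere2 (curve e t);
  curve_ends : forall e,
    [set curve e 0; curve e 1] = pos @` [set v | v \in ends e];
  curve_vertex : forall e (t : R) v, `]0, 1[ t -> curve e t <> pos v;
  curve_inj : forall e f (s t : R), `]0, 1[ s -> `]0, 1[ t ->
    curve e s = curve f t -> e = f /\ s = t }.

(* Such a [g] exists exactly when the embedded graph is invariant under the
   antipodal map, and it is then unique. *)
Definition antipodal_action (R : realType) (Z : graph)
    (emb : sphere_embedding R Z) (g : automorphism Z) : Prop :=
  (forall v, pos emb (aut_vertex g v) = - pos emb v) /\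
  (forall e, curve emb (aut_edge g e) @` `[0, 1] =
             -%R @` (curve emb e @` `[0, 1])).

(* Main.v *)
(* On the sphere, two antipodally symmetric connected parts of the graph must
   meet. Hence, for a perfect matching M, at most one component of M U gM is
   g-invariant, and a parity count, which uses that the number of vertices is
   divisible by 4, excludes this one too. So g exchanges the components of
   M U gM in pairs; the same holds for N1 U N2 when N1 and N2 are g-invariant
   perfect matchings. Given one component chosen from each pair, exchanging the
   two matchings on the other components turns (N1, N2) into a pair (M, gM) and
   conversely, so that the number of perfect matchings is the square of the
   number of g-invariant ones. The latter are the lifts of the perfect matchings
   of the quotient, none of which contains a loop. *)

Require Import Defs.
From mathcomp Require Import all_boot all_order all_fingroup all_algebra.
From mathcomp Require Import all_classical all_reals all_analysis.
From mathcomp Require Import ring lra.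

Set Implicit Arguments.
Unset Strict Implicit.
Unset Printing Implicit Defensive.

Import Order.TTheory GRing.Theory Num.Theory.
Import numFieldNormedType.Exports.

Local Open Scope ring_scope.
Local Open Scope classical_set_scope.

(** * Inner products and determinants relative to an axis *)

Section AxisAngle.
Variable R : realType.
Implicit Types x y z : 'rV[R]_3.

Definition coord3 k (k3 : (k < 3)%N) x := x ord0 (Ordinal k3).

Local Notation "x .[0]" := (@coord3 0 isT x) (at level 2).
Local Notation "x .[1]" := (@coord3 1 isT x) (at level 2).
Local Notation "x .[2]" := (@coord3 2 isT x) (at level 2).

Definition dot3 x y : R := x.[0] * y.[0] + x.[1] * y.[1] + x.[2] * y.[2].

(** The determinant. For a unit vector [x], with the plane orthogonal to [x] read as the complex
    numbers, [proj_dot x y z] and [triple3 x y z] are the real and imaginary parts of the conjugate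
    of [y] times [z], both projected. *)
Definition triple3 x y z : R :=
  x.[0] * (y.[1] * z.[2] - y.[2] * z.[1]) +
  x.[1] * (y.[2] * z.[0] - y.[0] * z.[2]) +
  x.[2] * (y.[0] * z.[1] - y.[1] * z.[0]).

(* For a unit vector [x], the inner product of the projections of [y] and [z]
   to the plane orthogonal to [x]. *)
Definition proj_dot x y z : R := dot3 y z - dot3 x y * dot3 x z.

Lemma dot3_sphere x : sphere2 x -> dot3 x x = 1.
Proof.
rewrite /sphere2 /= => <-; rewrite !big_ord_recr big_ord0 /= add0r.
by rewrite /dot3 !expr2 /coord3; congr (_ * _ + _ * _ + _ * _);
  congr (x _ _); apply: val_inj.
Qed.

Lemma coord3N k (k3 : (k < 3)%N) x : coord3 k3 (- x) = - coord3 k3 x.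
Proof. by rewrite /coord3 mxE. Qed.

Lemma proj_dotNl x y z : proj_dot (- x) y z = proj_dot x y z.
Proof. by rewrite /proj_dot /dot3 !coord3N; ring. Qed.

Lemma proj_dotNr x y z : proj_dot x y (- z) = - proj_dot x y z.
Proof. by rewrite /proj_dot /dot3 !coord3N; ring. Qed.

Lemma triple3Nl x y z : triple3 (- x) y z = - triple3 x y z.
Proof. by rewrite /triple3 !coord3N; ring. Qed.

(* Equality in the Cauchy-Schwarz inequality, through
   [|x|^2 |y|^2 - (x . y)^2 = |x * y|^2]. *)
Lemma proj_dot_gt0 x y : sphere2 x -> sphere2 y -> x <> y -> x <> - y ->
  0 < proj_dot x y y.
Proof.
move=> /dot3_sphere x1 /dot3_sphere y1 xy xNy.
have dot_inj (u v : 'rV[R]_3) : dot3 u u = 1 -> dot3 v v = 1 -> dot3 u v = 1 -> u = v.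
  move=> u1 v1 uv.
  have : (u.[0] - v.[0]) ^+ 2 + (u.[1] - v.[1]) ^+ 2 + (u.[2] - v.[2]) ^+ 2 = 0.
    transitivity (dot3 u u + dot3 v v - 2 * dot3 u v); first by rewrite /dot3; ring.
    by rewrite u1 v1 uv; ring.
  move=> /eqP; rewrite !paddr_eq0 ?addr_ge0 ?sqr_ge0// !sqrf_eq0 !subr_eq0.
  move=> /andP[/andP[/eqP e0 /eqP e1] /eqP e2].
  apply/rowP => -[[|[|[|//]]] i3]; rewrite (bool_irrelevance i3 isT).
  - exact: e0.
  - exact: e1.
  - exact: e2.
have le1 : 0 <= proj_dot x y y.
  have -> : proj_dot x y y = (x.[1] * y.[2] - x.[2] * y.[1]) ^+ 2 +
     (x.[2] * y.[0] - x.[0] * y.[2]) ^+ 2 + (x.[0] * y.[1] - x.[1] * y.[0]) ^+ 2.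
    rewrite /proj_dot -[dot3 y y]mul1r -x1 /dot3; ring.
  by rewrite !addr_ge0 ?sqr_ge0.
rewrite lt_neqAle le1 andbT eq_sym; apply/eqP => /eqP.
rewrite /proj_dot y1 -expr2 subr_eq0 eq_sym sqrf_eq1.
case/orP => /eqP d1; first exact/xy/dot_inj.
apply/xNy/dot_inj => //; move: y1 d1; rewrite /dot3 !coord3N => y1 d1.
  by rewrite !mulrNN.
by rewrite !mulrN -!opprD d1 opprK.
Qed.

(** The real part of [|z|^2 (conj y t) = (conj y z) (conj z t)] for projections; [triple3_mul] is
    the imaginary part. *)
Lemma proj_dot_mul x y z t : dot3 x x = 1 ->
  proj_dot x z z * proj_dot x y t =
  proj_dot x y z * proj_dot x z t - triple3 x y z * triple3 x z t.
Proof.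
move=> x1; have {}x1 : x.[2] ^+ 2 = 1 - x.[0] ^+ 2 - x.[1] ^+ 2.
  by rewrite -x1 /dot3; ring.
by rewrite /proj_dot /triple3 /dot3; ring: x1.
Qed.

Lemma triple3_mul x y z t : dot3 x x = 1 ->
  proj_dot x z z * triple3 x y t =
  proj_dot x y z * triple3 x z t + triple3 x y z * proj_dot x z t.
Proof.
move=> x1; have {}x1 : x.[2] ^+ 2 = 1 - x.[0] ^+ 2 - x.[1] ^+ 2.
  by rewrite -x1 /dot3; ring.
by rewrite /proj_dot /triple3 /dot3; ring: x1.
Qed.
End AxisAngle.

(** * Turning angles of polygonal paths around an axis *)

Section AngleSum.
Variable R : realType.
Implicit Types x y z : 'rV[R]_3.

(* The total angle by which the polygonal path [y :: l] turns around the axis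
   [x], provided that each step turns by less than a right angle. *)
Fixpoint angle_sum x y (l : seq 'rV[R]_3) : R :=
  if l is z :: l' then atan (triple3 x y z / proj_dot x y z) + angle_sum x z l'
  else 0.

(** The second conjunct keeps the points off the axis, so that the squared lengths of their
    projections can be divided out. *)
Definition small_turn x : rel 'rV[R]_3 :=
  fun y z => (0 < proj_dot x y z) && (0 < proj_dot x z z).

Lemma angle_sumN x y l : angle_sum (- x) y l = - angle_sum x y l.
Proof.
elim: l y => [|z l IHl] y /=; first by rewrite oppr0.
by rewrite IHl triple3Nl proj_dotNl mulNr atanN opprD.
Qed.

Lemma atan_polar (a b : R) : 0 < a -> exists2 r,
  0 < r & a = r * cos (atan (b / a)) /\ b = r * sin (atan (b / a)).
Proof.
move=> a0; have c0 : 0 < cos (atan (b / a)).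
  by rewrite cos_atan invr_gt0 sqrtr_gt0 ltr_pwDl// sqr_ge0.
exists (a / cos (atan (b / a))); first exact: divr_gt0.
split; first by rewrite divfK// gt_eqF.
by rewrite mulrAC -mulrA -/(tan _) atanK mulrC divfK// gt_eqF.
Qed.

(** The polar forms of the steps are multiplied: angles add, and moduli multiply up to the squared
    length of the intermediate projection. *)
Lemma angle_sum_polar x y l : dot3 x x = 1 -> 0 < proj_dot x y y ->
  path (small_turn x) y l -> exists2 r, 0 < r &
  proj_dot x y (last y l) = r * cos (angle_sum x y l) /\
  triple3 x y (last y l) = r * sin (angle_sum x y l).
Proof.
move=> x1; elim: l y => [|z l IHl] y yy /=.
  move=> _; exists (proj_dot x y y) => //; rewrite cos0 sin0 mulr1 mulr0; split => //.
  by rewrite /triple3; ring.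
case/andP => /andP[yz zz] /(IHl _ zz)[r r0 [rc rs]].
have [q q0] := atan_polar (triple3 x y z) yz.
set t := atan _; move: t => t [qc qs].
exists (q * r / proj_dot x z z); first by rewrite divr_gt0 ?mulr_gt0.
have zz0 : proj_dot x z z != 0 by rewrite gt_eqF.
split; apply: (mulfI zz0); rewrite ?proj_dot_mul ?triple3_mul// qc qs rc rs.
  by rewrite cosD; field.
by rewrite sinD; field.
Qed.

(** With total angle 0 the projection of the end point would be a positive multiple of that of [y],
    whereas [- y] gives a negative one. *)
Lemma angle_sum_antipodal x y l : dot3 x x = 1 -> 0 < proj_dot x y y ->
  path (small_turn x) y l -> last y l = - y -> angle_sum x y l != 0.
Proof.
move=> x1 yy /(angle_sum_polar x1 yy)[r r0 [rc _]] ly.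
apply/eqP => t0; move: rc; rewrite ly proj_dotNr t0 cos0 mulr1 => rE.
by move: yy; rewrite -oppr_lt0 rE ltNge ltW.
Qed.

Lemma continuous_coord3 (T : topologicalType) k (k3 : (k < 3)%N) (f : T -> 'rV[R]_3) :
  continuous f -> continuous (fun s => coord3 k3 (f s)).
Proof.
by move=> fc s; apply: continuous_comp (fc s) _; exact: coord_continuous.
Qed.

Lemma continuous_dot3 (T : topologicalType) (f g : T -> 'rV[R]_3) :
  continuous f -> continuous g -> continuous (fun s => dot3 (f s) (g s)).
Proof.
move=> fc gc s; have F k k3 := @continuous_coord3 _ k k3 _ fc s.
have G k k3 := @continuous_coord3 _ k k3 _ gc s.
exact: (cvgD (cvgD (cvgM (F _ _) (G _ _)) (cvgM (F _ _) (G _ _)))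
  (cvgM (F _ _) (G _ _))).
Qed.

Lemma continuous_proj_dot (T : topologicalType) (f g h : T -> 'rV[R]_3) :
  continuous f -> continuous g -> continuous h ->
  continuous (fun s => proj_dot (f s) (g s) (h s)).
Proof.
move=> fc gc hc s.
apply: cvgB; first exact: continuous_dot3 gc hc s.
by apply: cvgM; [exact: continuous_dot3 fc gc s|exact: continuous_dot3 fc hc s].
Qed.

Lemma continuous_triple3 (T : topologicalType) (f g h : T -> 'rV[R]_3) :
  continuous f -> continuous g -> continuous h ->
  continuous (fun s => triple3 (f s) (g s) (h s)).
Proof.
move=> fc gc hc s; have F k k3 := @continuous_coord3 _ k k3 _ fc s.
have G k k3 := @continuous_coord3 _ k k3 _ gc s.
have H k k3 := @continuous_coord3 _ k k3 _ hc s.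
have minor i j i3 j3 := cvgB (cvgM (G i i3) (H j j3)) (cvgM (G j j3) (H i i3)).
apply: cvgD; [apply: cvgD|]; apply: cvgM; first [exact: F | exact: minor].
Qed.

Lemma continuous_angle_sum (T : topologicalType) (f : T -> 'rV[R]_3) y l :
  continuous f -> (forall s, path (small_turn (f s)) y l) ->
  continuous (fun s => angle_sum (f s) y l).
Proof.
move=> fc; elim: l y => [|z l IHl] y /= fP; first by move=> s; exact: cvg_cst.
have cc w : continuous (fun _ : T => w : 'rV[R]_3) by move=> s; exact: cvg_cst.
move=> s; apply: cvgD; last by apply: IHl => {}s; case/andP: (fP s).
apply: continuous_comp; last exact: continuous_atan.
apply: cvgM; first exact: continuous_triple3.
apply: cvgV; last exact: continuous_proj_dot.
by rewrite gt_eqF//; case/andP: (fP s) => /andP[].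
Qed.

(** By the intermediate value theorem, a change of sign would produce an axis with angle 0, which
    [angle_sum_antipodal] excludes. *)
Lemma angle_sum_same_sign (f : R -> 'rV[R]_3) y l a b : continuous f ->
  (forall s, dot3 (f s) (f s) = 1) -> (forall s, 0 < proj_dot (f s) y y) ->
  (forall s, path (small_turn (f s)) y l) -> last y l = - y ->
  (0 < angle_sum (f a) y l) = (0 < angle_sum (f b) y l).
Proof.
move=> fc f1 fy fP ly.
suff pos_le c d : 0 < angle_sum (f c) y l -> 0 < angle_sum (f d) y l.
  by apply/idP/idP; exact: pos_le.
move=> c0; rewrite ltNge; apply/negP => d0.
have tc := continuous_angle_sum fc fP.
suff [s s0] : exists s, angle_sum (f s) y l = 0.
  by have := angle_sum_antipodal (f1 s) (fy s) (fP s) ly; rewrite s0 eqxx.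
have tw (u v : R) : {within `[u, v], continuous (fun s => angle_sum (f s) y l)}.
  exact: continuous_subspaceT.
case: (leP c d) => [cd|/ltW dc].
  case: (IVT cd (tw _ _) (v := 0)); last by move=> s _ sE; exists s.
  by rewrite ge_min le_max d0 (ltW c0) orbT.
case: (IVT dc (tw _ _) (v := 0)); last by move=> s _ sE; exists s.
by rewrite ge_min le_max d0 (ltW c0) orbT.
Qed.

End AngleSum.

(** * Uniform estimates and subdivisions on the unit interval *)

Section Segments.
Variable R : realType.

(** Retraction of the line onto the unit interval; composing with it makes a curve continuous on the
    whole line. *)
Definition clamp01 (t : R) : R := Num.max 0 (Num.min t 1).

Lemma clamp01_itv t : `[0, 1]%classic (clamp01 t).
Proof.
by rewrite /= in_itv /= /clamp01 le_max lexx /= ge_max ler01 /= ge_min lexx orbT.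
Qed.

Lemma clamp01_id t : `[0, 1]%classic t -> clamp01 t = t.
Proof.
rewrite /= in_itv /= => /andP[t0 t1].
by rewrite /clamp01 (min_idPl t1) (max_idPr t0).
Qed.

Lemma continuous_clamp01 : continuous clamp01.
Proof.
move=> t; apply: (@continuous_max R R (fun=> 0) (fun u => Num.min u 1)).
  exact: cvg_cst.
by apply: (@continuous_min R R (fun u => u) (fun=> 1)); [exact: cvg_id|exact: cvg_cst].
Qed.

Lemma continuous_comp_clamp01 (T : topologicalType) (f : R -> T) :
  {within `[0, 1], continuous f} -> continuous (f \o clamp01).
Proof.
move=> /subspace_continuousP fc t.
apply: cvg_trans (fc _ (clamp01_itv t)) => A /= fA.
have := continuous_clamp01 fA; rewrite nbhs_filterE /=.
by apply: filterS => s; apply; exact: clamp01_itv.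
Qed.

(** Compactness of the unit square makes the distance [d] uniform in [s] and [t]. *)
Lemma near_diagonal_gt0 (F : R * (R * R) -> R) : continuous F ->
  (forall s t, 0 < F (s, (t, t))) ->
  \forall d \near 0^'+, forall s t t', `[0, 1]%classic s -> `[0, 1]%classic t ->
    `|t - t'| < d -> 0 < F (s, (t, t')).
Proof.
move=> Fc F0.
have /compact_near_coveringP cover :=
  compact_setX (@segment_compact R 0 1) (@segment_compact R 0 1).
have : \forall d \near 0^'+, `[0, 1] `*` `[0, 1] `<=`
    (fun st : R * R => forall t', `|st.2 - t'| < d -> 0 < F (st.1, (st.2, t'))).
  apply: cover => -[s t] _.
  have : \forall u \near (s, (t, t)), 0 < F u.
    exact: (cvgr_gt _ (Fc (s, (t, t))) _ (F0 s t)).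
  move=> /nbhs_ballP[e /= e0 He].
  near=> p d => t' /= pt'; apply: (He (_, (_, _))) => /=.
  have [p1 p2] : ball (s, t) (e / 2) p.
    near: p; apply: nbhsx_ballx; by rewrite divr_gt0.
  have de : d < e / 2 by near: d; apply: nbhs_right_lt; rewrite divr_gt0.
  move: p1 p2; rewrite /ball /= => p1 p2.
  split; [|split]; rewrite /ball /=.
  - by rewrite (lt_trans p1)// ltr_pdivrMr// ltr_pMr// ltr1n.
  - by rewrite (lt_trans p2)// ltr_pdivrMr// ltr_pMr// ltr1n.
  rewrite [ltRHS]splitr (le_lt_trans (ler_distD p.2 _ _))// ltrD//.
  exact: lt_trans pt' de.
apply: filterS => d Hd s t t' s01 t01 tt'; exact: (Hd (s, t)).
Unshelve. all: by end_near.
Qed.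

Lemma segment_path (T : Type) (r : rel T) (f : R -> T) (d : R) : 0 < d ->
  (forall t t', `[0, 1]%classic t -> `[0, 1]%classic t' -> `|t - t'| < d -> r (f t) (f t')) ->
  forall a b, `[0, 1]%classic a -> `[0, 1]%classic b ->
  exists2 l, path r (f a) l & last (f a) l = f b.
Proof.
move=> d0 rf a b a01 b01.
have [N Nd] : exists N : nat, `|b - a| / N.+1%:R < d.
  have [N] : exists N : nat, `|b - a| / d < N.+1%:R.
    exists (Num.truncn (`|b - a| / d)); exact: truncnS_gt.
  by rewrite ltr_pdivrMr// mulrC => HN; exists N; rewrite ltr_pdivrMr// mulrC.
pose p k := a + (b - a) * (k%:R / N.+1%:R).
have p01 k : (k <= N.+1)%N -> `[0, 1]%classic (p k).
  move=> kN; have q0 : 0 <= k%:R / N.+1%:R :> R by rewrite divr_ge0.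
  have q1 : k%:R / N.+1%:R <= 1 :> R by rewrite ler_pdivrMr// mul1r ler_nat.
  move: a01 b01; rewrite /p /= !in_itv /= => /andP[? ?] /andP[? ?].
  by set q := _ / _ in q0 q1 *; apply/andP; split; nra.
suff H k : (k <= N.+1)%N -> exists2 l, path r (f a) l & last (f a) l = f (p k).
  have [l lP lE] := H N.+1 (leqnn _); exists l => //.
  by rewrite lE /p divff ?pnatr_eq0// mulr1 addrC subrK.
elim: k => [_|k IHk kN]; first by exists [::]; rewrite // /p mul0r mulr0 addr0.
have [l lP lE] := IHk (ltnW kN).
exists (rcons l (f (p k.+1))); last by rewrite last_rcons.
rewrite rcons_path lP lE /=; apply: rf; [exact/p01/ltnW|exact: p01|].
suff -> : p k - p k.+1 = - ((b - a) / N.+1%:R).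
  by rewrite normrN normrM normfV [`|N.+1%:R|]ger0_norm.
have m0 : N.+1%:R != 0 :> R by rewrite pnatr_eq0.
by rewrite /p -[k.+1%:R]natr1; set m := N.+1%:R in m0 *; field.
Qed.

End Segments.

(** * Connected components of the subgraph with a given edge set *)

Section GraphConnectivity.
Variables (Z : graph) (U : {set edge Z}).

Definition adj : rel (vertex Z) :=
  fun v w => [exists e in U, (v \in ends e) && (w \in ends e)].

Lemma adjP v w :
  reflect (exists e, [/\ e \in U, v \in ends e & w \in ends e]) (adj v w).
Proof.
apply: (iffP exists_inP) => [[e eU /andP[ve we]]|[e [eU ve we]]]; exists e => //.
by rewrite ve we.
Qed.

Lemma connect_adj_sym : connect_sym adj.
Proof.
apply: sym_connect_sym => v w; apply: eq_existsb => e.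
by rewrite [(v \in _) && _]andbC.
Qed.

Lemma connect_ends e v w : e \in U -> v \in ends e -> w \in ends e ->
  connect adj v w.
Proof. by move=> eU ve we; apply/connect1/adjP; exists e. Qed.

Lemma connect_aut (g : automorphism Z) v w :
  (forall e, (aut_edge g e \in U) = (e \in U)) ->
  connect adj v w -> connect adj (aut_vertex g v) (aut_vertex g w).
Proof.
move=> gU /connectP[p + ->]; elim: p v => [|u p IHp] v //= /andP[vu /IHp].
apply: connect_trans; have /adjP[e [eU ve ue]] := vu.
by apply: (connect_ends (e := aut_edge g e)); rewrite ?gU// aut_ends imset_f.
Qed.

Lemma connect_edge v w : v != w -> connect adj v w ->
  exists2 e, e \in U & v \in ends e.
Proof.
move=> vw /connectP[[|u p] /=]; first by move=> _ wE; rewrite wE eqxx in vw.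
by move=> /andP[/adjP[e [eU ve _]] _] _; exists e.
Qed.

Definition in_component v : pred (edge Z) :=
  fun e => (e \in U) && [exists u in ends e, connect adj v u].

Lemma in_componentP v e u : in_component v e -> u \in ends e -> connect adj v u.
Proof.
case/andP => eU /exists_inP[x xe vx] ue.
by apply: connect_trans vx (connect_ends eU xe ue).
Qed.

Lemma in_component_ends v e u : e \in U -> u \in ends e -> connect adj v u ->
  in_component v e.
Proof. by move=> eU ue vu; rewrite /in_component eU; apply/exists_inP; exists u. Qed.

(** Paths along the edges are concatenated. This serves for subdivided curves and also, with
    equality for [r], to propagate a value through a component. *)
Lemma path_along_component (T : Type) (r : rel T) (f : vertex Z -> T) v w :
  (forall e a b, in_component v e -> a \in ends e -> b \in ends e ->
    exists2 l, path r (f a) l & last (f a) l = f b) ->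
  connect adj v w -> exists2 l, path r (f v) l & last (f v) l = f w.
Proof.
move=> rf /connectP[p + ->]; elim/last_ind: p => [|p u IHp]; first by exists [::].
rewrite rcons_path last_rcons => /andP[vp pu].
have [l lP lE] := IHp vp; have /adjP[e [eU pe ue]] := pu.
have vpe : connect adj v (last v p) by apply/connectP; exists p.
have [m mP mE] := rf e _ _ (in_component_ends eU pe vpe) pe ue.
by exists (l ++ m); rewrite ?last_cat ?cat_path ?lP lE.
Qed.

End GraphConnectivity.

(** * Symmetric components of an antipodally invariant graph on the sphere *)

Section Antipodal.
Variables (R : realType) (Z : graph) (emb : sphere_embedding R Z).
Variables (g : automorphism Z) (act : antipodal_action emb g).

Lemma sphere2_neqN (x : 'rV[R]_3) : sphere2 x -> x <> - x.
Proof.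
move=> /dot3_sphere x1 xE; have : dot3 x x = 0; last first.
  by move/eqP; rewrite x1 oner_eq0.
have x0 k (k3 : (k < 3)%N) : coord3 k3 x = 0.
  by apply/eqP; rewrite -eqNr -coord3N -xE.
by rewrite /dot3 !x0 !mul0r !addr0.
Qed.

Lemma aut_vertexK : involutive (aut_vertex g).
Proof. by move=> v; apply: (@pos_inj _ _ emb); rewrite !act.1 opprK. Qed.

Lemma aut_vertex_neq v : v != aut_vertex g v.
Proof.
apply/eqP => vE; apply: (sphere2_neqN (pos_sphere emb v)).
by rewrite -act.1 -vE.
Qed.

Lemma curve_pos e a : a \in ends e ->
  exists2 s, `[0, 1]%classic s & curve emb e s = pos emb a.
Proof.
move=> ae; have : [set curve emb e 0; curve emb e 1] (pos emb a).
  by rewrite curve_ends; exists a.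
by case=> ->; [exists 0|exists 1] => //; rewrite /= in_itv /= lexx ler01.
Qed.

Variant curve_spec e (s : R) : Prop :=
  | CurveInterior of `]0, 1[%classic s
  | CurveEnd a of a \in ends e & curve emb e s = pos emb a.

Lemma curveP e s : `[0, 1]%classic s -> curve_spec e s.
Proof.
have He : forall x, [set curve emb e 0; curve emb e 1] x ->
    exists2 a, a \in ends e & x = pos emb a.
  by move=> x; rewrite curve_ends => -[a ae <-]; exists a.
rewrite /= in_itv /= !le_eqVlt => /andP[/orP[/eqP <- _|s0 /orP[/eqP ->|s1]]].
- by have [|a ae aE] := He (curve emb e 0); [left|exact: CurveEnd aE].
- by have [|a ae aE] := He (curve emb e 1); [right|exact: CurveEnd aE].
- by apply: CurveInterior; rewrite /= in_itv /= s0.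
Qed.

Lemma curve_meet e f s t : `[0, 1]%classic s -> `[0, 1]%classic t ->
  curve emb e s = curve emb f t ->
  e = f \/ exists2 a, a \in ends e & a \in ends f.
Proof.
move=> /(@curveP e)[si|a ae aE] /(@curveP f)[ti|b bf bE] st.
- by left; have [] := curve_inj si ti st.
- by have := @curve_vertex _ _ emb e s b si; rewrite st bE.
- by have := @curve_vertex _ _ emb f t a ti; rewrite -st aE.
- right; exists a => //; suff -> : a = b by [].
  by apply: (@pos_inj _ _ emb); rewrite -aE st.
Qed.

Lemma curve_antipode e s : `[0, 1]%classic s ->
  exists2 t, `[0, 1]%classic t & curve emb (aut_edge g e) t = - curve emb e s.
Proof.
move=> s01; have : (-%R @` (curve emb e @` `[0, 1])) (- curve emb e s).
  by exists (curve emb e s) => //; exists s.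
by rewrite -act.2 => -[t t01 tE]; exists t.
Qed.

(** Because of parallel edges, the end vertices do not suffice. Negating the midpoint of [e] twice
    gives it back, and an interior point of a curve determines the edge. *)
Lemma aut_edgeK : involutive (aut_edge g).
Proof.
move=> e; have half : `]0, 1[%classic (2^-1 : R).
  by rewrite /= in_itv /= invr_gt0 ltr0n invf_lt1// ltr1n.
have half' : `[0, 1]%classic (2^-1 : R).
  by move: half; rewrite /= !in_itv /= => /andP[/ltW -> /ltW ->].
have [t t01 tE] := curve_antipode e half'.
have [s s01 sE] := curve_antipode (aut_edge g e) t01.
rewrite tE opprK in sE.
case: (curveP (aut_edge g (aut_edge g e)) s01) => [si|a _ aE].
  by have [] := curve_inj si half sE.
by have := @curve_vertex _ _ emb e _ a half; rewrite -sE aE.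
Qed.

Variable U : {set edge Z}.
Hypothesis gU : forall e, (aut_edge g e \in U) = (e \in U).
Local Notation conn := (connect (adj U)).

Section Disjoint.
Variables v w : vertex Z.
Hypotheses (vw : ~~ conn v w) (wgw : conn w (aut_vertex g w)).

Lemma component_curve_neq e f s t : in_component U v e -> in_component U w f ->
  `[0, 1]%classic s -> `[0, 1]%classic t -> curve emb e s <> curve emb f t.
Proof.
move=> ve wf s01 t01 /(curve_meet s01 t01).
have disj a : a \in ends e -> a \in ends f -> False.
  move=> ae af; move/negP: vw; apply; apply: connect_trans (in_componentP ve ae) _.
  by rewrite connect_adj_sym; exact: in_componentP wf af.
case=> [ef|[a ae af]]; last exact: disj ae af.
have [/card_gt0P[a ae] _] := andP (ends_card e).
by apply: (disj a ae); rewrite -ef.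
Qed.

(** By [wgw] the component of [w] is closed under [g], so the antipodes of its points lie on its own
    curves. *)
Lemma component_curve_neqN e f s t : in_component U v e -> in_component U w f ->
  `[0, 1]%classic s -> `[0, 1]%classic t -> curve emb e s <> - curve emb f t.
Proof.
move=> ve wf s01 /(curve_antipode f)[t' t01' <-].
apply: component_curve_neq => //; case/andP: wf => fU /exists_inP[a af wa].
apply: (@in_component_ends _ _ _ _ (aut_vertex g a)); rewrite ?gU//.
  by rewrite aut_ends imset_f.
exact: connect_trans wgw (connect_aut gU wa).
Qed.

End Disjoint.
(* Otherwise the components of [v] and [w] would be disjoint antipodal subsets
   of the sphere. A path in the second one from [w] to its antipode [- w] then
   turns around every axis [x] in the first one by an angle that is never 0,
   is odd in [x], and is continuous along the edges. *)
Lemma antipodal_components_meet v w :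
  conn v (aut_vertex g v) -> conn w (aut_vertex g w) -> conn v w.
Proof.
move=> vgv wgw; apply/negPn/negP => vw.
pose c e : R -> 'rV[R]_3 := curve emb e \o @clamp01 R.
have cc e : continuous (c e) by exact/continuous_comp_clamp01/curve_continuous.
have cS e s : sphere2 (c e s) by exact/curve_sphere/clamp01_itv.
have cE e s : `[0, 1]%classic s -> c e s = curve emb e s.
  by move=> s01; rewrite /c /= clamp01_id.
have cpos e a : a \in ends e -> exists2 s, `[0, 1]%classic s & c e s = pos emb a.
  by case/curve_pos => s s01 <-; exists s => //; exact: cE.
have cgt0 e f s t : in_component U v e -> in_component U w f ->
    0 < proj_dot (c e s) (c f t) (c f t).
  move=> ve wf; apply: proj_dot_gt0; rewrite ?cS//.
  - by apply: (component_curve_neq vw ve wf); exact: clamp01_itv.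
  - by apply: (component_curve_neqN vw wgw ve wf); exact: clamp01_itv.
(* There are finitely many pairs of edges, so one bound [d] serves them all. *)
have [d [d0 Hd]] : exists d : R, 0 < d /\
    forall e f, in_component U v e -> in_component U w f ->
      forall s t t', `[0, 1]%classic s -> `[0, 1]%classic t ->
      `|t - t'| < d -> 0 < proj_dot (c e s) (c f t) (c f t').
  suff : \forall d \near 0^'+, 0 < d /\ forall ef : edge Z * edge Z,
      in_component U v ef.1 -> in_component U w ef.2 ->
      forall s t t', `[0, 1]%classic s -> `[0, 1]%classic t ->
      `|t - t'| < d -> 0 < proj_dot (c ef.1 s) (c ef.2 t) (c ef.2 t').
    move=> /filter_ex[d [d0 Hd]]; exists d; split => // e f; exact: (Hd (e, f)).
  near=> d; split; near: d; first exact: nbhs_right_gt.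
  apply: filter_forall => -[e f] /=.
  have [ve|] := boolP (in_component U v e); last by move=> _; apply: nearW.
  have [wf|] := boolP (in_component U w f); last by move=> _; apply: nearW.
  have := @near_diagonal_gt0 R (fun u => proj_dot (c e u.1) (c f u.2.1) (c f u.2.2)).
  have F1 : continuous (fun u : R * (R * R) => c e u.1).
    by move=> u; apply: continuous_comp; [exact: cvg_fst|exact: cc].
  have F2 : continuous (fun u : R * (R * R) => c f u.2.1).
    move=> u; apply: (continuous_comp (f := fun u : R * (R * R) => u.2.1)); last exact: cc.
    by apply: continuous_comp; [exact: cvg_snd|exact: cvg_fst].
  have F3 : continuous (fun u : R * (R * R) => c f u.2.2).
    move=> u; apply: (continuous_comp (f := fun u : R * (R * R) => u.2.2)); last exact: cc.
    by apply: continuous_comp; [exact: cvg_snd|exact: cvg_snd].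
  move/(_ (continuous_proj_dot F1 F2 F3) (fun s t => cgt0 e f s t ve wf)).
  by apply: filterS => d' Hd' _ _ s t t'; exact: Hd'.
(* The turn is small around all axes of the first component at once, so that a single path [l]
   serves for every axis. *)
pose r y z := `[< forall e s, in_component U v e -> small_turn (c e s) y z >].
have [l lP lE] : exists2 l, path r (pos emb w) l &
    last (pos emb w) l = pos emb (aut_vertex g w).
  apply: (path_along_component _ wgw) => f a b wf /(@cpos f)[s s01 <-] /(@cpos f)[t t01 <-].
  apply: (segment_path d0 _ s01 t01) => q q' q01 q01' qq'.
  apply/asboolP => e u ve; rewrite /small_turn cgt0// andbT.
  have -> : c e u = c e (clamp01 u) by rewrite /c /= (clamp01_id (clamp01_itv u)).
  by apply: Hd => //; exact: clamp01_itv.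
rewrite act.1 in lE.
have cP e s : in_component U v e -> path (small_turn (c e s)) (pos emb w) l.
  by move=> ve; apply: sub_path lP => y z /asboolP; apply.
have [f fU wf] := connect_edge (aut_vertex_neq w) wgw.
have wf' := in_component_ends fU wf (connect0 _ w).
have [q _ qE] := cpos f w wf.
have wgt0 e s : in_component U v e -> 0 < proj_dot (c e s) (pos emb w) (pos emb w).
  by move=> ve; rewrite -qE; exact: cgt0.
pose sgn a := 0 < angle_sum (pos emb a) (pos emb w) l.
have sgnE e a b : in_component U v e -> a \in ends e -> b \in ends e -> sgn a = sgn b.
  move=> ve /(@cpos e)[s _ sE] /(@cpos e)[t _ tE]; rewrite /sgn -sE -tE.
  apply: angle_sum_same_sign => // u; first exact: dot3_sphere.
  - exact: wgt0.
  - exact: cP.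
have [e eU vE] := connect_edge (aut_vertex_neq v) vgv.
have ve := in_component_ends eU vE (connect0 _ v).
have [s _ sE] := cpos e v vE.
have : angle_sum (pos emb v) (pos emb w) l != 0.
  by rewrite -sE; apply: angle_sum_antipodal; rewrite ?dot3_sphere ?wgt0 ?cP.
have : sgn v = sgn (aut_vertex g v).
  have [|m mP <-] := path_along_component (r := eq_op) (f := sgn) _ vgv.
    move=> e' a b ve' ae be; exists [:: sgn b] => //=.
    by rewrite andbT; apply/eqP; exact: sgnE ae be.
  by elim: m (sgn v) mP => //= x m IHm y /andP[/eqP -> /IHm].
rewrite /sgn act.1 angle_sumN oppr_gt0.
by case: ltgtP.
Unshelve. all: by end_near.
Qed.

End Antipodal.

Local Close Scope classical_set_scope.
Local Close Scope ring_scope.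

(** * Perfect matchings of a bipartite graph as color-reversing involutions *)

Section Mates.
Variables (Z : graph) (black : vertex Z -> bool).
Hypothesis bip : bipartition black.
Implicit Types (A B : {set edge Z}) (v w : vertex Z).

Lemma perfect_matchingP A : reflect
  (forall v, exists2 e, e \in A /\ v \in ends e &
    forall f, f \in A -> v \in ends f -> f = e)
  (perfect_matching A).
Proof.
apply: (iffP forallP) => [pmA v|pmA v].
  have /cards1P[e eE] := pmA v; have : e \in [set e] := set11 e.
  rewrite -eE inE => /andP[eA ve]; exists e => // f fA vf.
  by apply/set1P; rewrite -eE inE fA.
have [e [eA ve] eE] := pmA v; apply/cards1P; exists e; apply/setP => f.
rewrite !inE; apply/andP/eqP => [[fA vf]|-> //]; exact: eE.
Qed.

Lemma ends_black e v w : v \in ends e -> w \in ends e ->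
  black v = black w -> v = w.
Proof.
have [x [y [-> bx wy]]] := bip e.
by rewrite !inE => /orP[]/eqP-> /orP[]/eqP->; rewrite // bx (negbTE wy).
Qed.

Lemma ends_other e v : v \in ends e -> exists2 w, w \in ends e & black w = ~~ black v.
Proof.
have [x [y [-> bx wy]]] := bip e.
rewrite !inE => /orP[]/eqP->; [exists y|exists x]; rewrite ?inE ?eqxx ?orbT//.
  by rewrite bx (negbTE wy).
by rewrite bx wy.
Qed.

(** The color test excludes [v], which is adjacent to itself as soon as an edge of [A] contains it.
    For a perfect matching the default [v] is never reached. *)
Definition mate A v : vertex Z :=
  odflt v [pick w | adj A v w & black w == ~~ black v].

Section PerfectMatching.
Variable A : {set edge Z}.
Hypothesis pmA : perfect_matching A.

Lemma mate_adj v : adj A v (mate A v).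
Proof.
rewrite /mate; case: pickP => [w /andP[]//|none].
have [e [eA ve] _] := perfect_matchingP _ pmA v.
have [w we bw] := ends_other ve; have /negbT/negP[] := none w.
by rewrite bw eqxx andbT; apply/adjP; exists e.
Qed.

Lemma mate_black v : black (mate A v) = ~~ black v.
Proof.
rewrite /mate; case: pickP => [w /andP[_ /eqP]//|none].
have [e [eA ve] _] := perfect_matchingP _ pmA v.
have [w we bw] := ends_other ve; have /negbT/negP[] := none w.
by rewrite bw eqxx andbT; apply/adjP; exists e.
Qed.

Lemma mate_unique v w : adj A v w -> black w = ~~ black v -> w = mate A v.
Proof.
move=> /adjP[e [eA ve we]] bw.
have /adjP[f [fA vf mf]] := mate_adj v.
have [h [hA vh] hE] := perfect_matchingP _ pmA v.
rewrite (hE f fA vf) in mf; rewrite (hE e eA ve) in we.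
by apply: (ends_black we mf); rewrite bw mate_black.
Qed.

Lemma mateK : involutive (mate A).
Proof.
move=> v; apply/esym/mate_unique; last by rewrite mate_black negbK.
have /adjP[e [eA ve we]] := mate_adj v; by apply/adjP; exists e.
Qed.

Definition mate_perm : {perm vertex Z} := perm (inv_inj mateK).

Lemma mate_permE v : mate_perm v = mate A v.
Proof. by rewrite permE. Qed.

End PerfectMatching.

Lemma connect_setU1 A B v w : adj A v w -> connect (adj (A :|: B)) v w.
Proof.
move=> /adjP[e [eA ve we]].
by apply: (connect_ends _ ve we); rewrite inE eA.
Qed.

Section TwoMatchings.
Variables A B : {set edge Z}.
Hypotheses (pmA : perfect_matching A) (pmB : perfect_matching B).

Definition mate_rotation : {perm vertex Z} := (mate_perm pmB * mate_perm pmA)%g.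

Lemma mate_rotationE v : mate_rotation v = mate A (mate B v).
Proof. by rewrite permM !mate_permE. Qed.

(* The connected components of the union of two perfect matchings are the
   orbits of the dihedral group generated by the two mate involutions. *)
Lemma connect_porbit v w : connect (adj (A :|: B)) v w -> black w = black v ->
  w \in porbit mate_rotation v.
Proof.
have orb x : (mate_rotation x \in porbit mate_rotation v) = (x \in porbit mate_rotation v).
  by rewrite -!eq_porbit_mem -[in RHS](porbit_perm mate_rotation 1 x) expg1.
move=> /connectP[p + ->] bw.
(* Strengthened to end points of either color: one whose color differs from that of [v] is replaced
   by its mate in [A]. *)
suff: forall p, path (adj (A :|: B)) v p -> let w := last v p in
    if black w == black v then w \in porbit mate_rotation v
    else mate A w \in porbit mate_rotation v.
  by move=> H /H /=; rewrite bw eqxx.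
elim/last_ind=> {p w bw}[|p u IHp] /=; first by rewrite eqxx porbit_id.
rewrite rcons_path last_rcons => /andP[/IHp {IHp}]/=; set w := last v p.
move=> IH /adjP[e [+ we ue]]; rewrite inE.
have [buw _|buw] := boolP (black u == black w).
  by rewrite (ends_black ue we (eqP buw)).
have {}buw : black u = ~~ black w by move: buw; case: (black u) (black w) => -[].
case/orP => eA; [have -> : u = mate A w | have -> : u = mate B w];
  try by apply: mate_unique => //; apply/adjP; exists e.
  by move: IH; rewrite mate_black// mateK//; case: (black w) (black v) => -[].
move: IH; rewrite mate_black// -mate_rotationE orb -[in mate B w \in _]orb.
rewrite mate_rotationE mateK//.
by case: (black w) (black v) => -[].
Qed.

End TwoMatchings.
End Mates.

(** * Matchings under a color-reversing involution *)

Section Symmetry.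
Variables (Z : graph) (black : vertex Z -> bool) (g : automorphism Z) (n : nat).
Hypotheses (bip : bipartition black) (card_Z : #|vertex Z| = (4 * n)%N).
Hypothesis g_swap : forall v, black (aut_vertex g v) = ~~ black v.
Hypotheses (gVK : involutive (aut_vertex g)) (gEK : involutive (aut_edge g)).
Local Notation gV := (aut_vertex g).
Local Notation gE := (aut_edge g).

Definition invariant (U : {set edge Z}) : Prop := forall e, (gE e \in U) = (e \in U).

(** Together with [gVK] and [gEK], this is all that the counting retains of the embedding. *)
Hypothesis components_meet : forall U, invariant U -> forall v w,
  connect (adj U) v (gV v) -> connect (adj U) w (gV w) -> connect (adj U) v w.

Definition aut_im (A : {set edge Z}) : {set edge Z} := [set e | gE e \in A].

Lemma in_aut_ends v e : (gV v \in ends (gE e)) = (v \in ends e).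
Proof. by rewrite aut_ends mem_imset//; exact: perm_inj. Qed.

Lemma in_ends_aut v e : (v \in ends (gE e)) = (gV v \in ends e).
Proof. by rewrite -[v in LHS]gVK in_aut_ends. Qed.

Lemma aut_imK : involutive aut_im.
Proof. by move=> A; apply/setP => e; rewrite !inE gEK. Qed.

Lemma invariantP A : invariant A <-> aut_im A = A.
Proof.
split=> [iA|AE e]; first by apply/setP => e; rewrite inE.
by rewrite -{1}AE inE gEK.
Qed.

Lemma invariant_setU A B : invariant A -> invariant B -> invariant (A :|: B).
Proof. by move=> iA iB e; rewrite !inE iA iB. Qed.

Lemma invariant_setU_aut_im A : invariant (A :|: aut_im A).
Proof. by move=> e; rewrite !inE gEK orbC. Qed.

Lemma perfect_matching_aut_im A : perfect_matching A -> perfect_matching (aut_im A).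
Proof.
move=> /perfect_matchingP pmA; apply/perfect_matchingP => v.
have [e [eA ve] eU] := pmA (gV v); exists (gE e).
  by rewrite inE gEK in_ends_aut.
by move=> f; rewrite inE => fA vf; rewrite -[f]gEK (eU (gE f)) ?in_aut_ends.
Qed.

Lemma adj_aut_im A v w : adj (aut_im A) v w = adj A (gV v) (gV w).
Proof.
apply/adjP/adjP => -[e [eA ve we]]; exists (gE e).
  by rewrite inE in eA; rewrite !in_aut_ends eA ve we.
by rewrite inE gEK !in_ends_aut eA ve we.
Qed.

Lemma mate_aut_im A v : perfect_matching A ->
  mate black (aut_im A) (gV v) = gV (mate black A v).
Proof.
move=> pmA; apply/esym/(mate_unique bip (perfect_matching_aut_im pmA)).
  by rewrite adj_aut_im !gVK; exact: mate_adj.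
by rewrite !g_swap mate_black.
Qed.

(** For an invariant [U]: no component is mapped to itself, so [g] exchanges the components in
    pairs. *)
Definition free (U : {set edge Z}) : Prop := forall v, ~~ connect (adj U) v (gV v).

(* Chooses one component in each pair of components exchanged by [g]. *)
Definition side (U : {set edge Z}) v : bool :=
  (enum_rank (fingraph.root (adj U) v) < enum_rank (fingraph.root (adj U) (gV v)))%N.

Lemma side_connect U v w : invariant U -> connect (adj U) v w -> side U v = side U w.
Proof.
move=> iU vw; have gvw := connect_aut iU vw.
have s := connect_adj_sym U; rewrite /side.
by move: vw gvw => /(fingraph.rootP s) -> /(fingraph.rootP s) ->.
Qed.

Lemma side_swap U v : ~~ connect (adj U) v (gV v) -> side U (gV v) = ~~ side U v.
Proof.
have s := connect_adj_sym U; rewrite -(root_connect s) /side gVK => neq.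
by case: ltngtP => // /ord_inj/enum_rank_inj eq; rewrite eq eqxx in neq.
Qed.

(** [g] exchanges the colors, so half of the vertices are black. The evenness of this number is the
    parity used in [free_matching_aut_im]. *)
Lemma card_black : #|[set v | black v]| = (2 * n)%N.
Proof.
have cB : #|[set v | black v]| = #|~: [set v | black v]|.
  rewrite -(card_imset _ (@perm_inj _ gV)); apply: eq_card => v.
  rewrite !inE; apply/imsetP/idP => [[u + ->]|bv].
    by rewrite inE g_swap => ->.
  by exists (gV v); rewrite ?inE ?g_swap ?gVK.
have := cardsC [set v | black v]; rewrite -cB card_Z addnn -muln2 => /eqP.
by rewrite (_ : 4 * n = (2 * n) * 2)%N ?eqn_pmul2r//; [move=> /eqP | rewrite mulnAC].
Qed.

(** If the orbit length [m] were even, the even exponent would stay even modulo [m]; but it must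
    reduce to 1, as the first [m] iterates are distinct. *)
Lemma odd_porbit (T : finType) (s : {perm T}) x k :
  (s ^+ k.*2)%g x = s x -> odd #|porbit s x|.
Proof.
rewrite permX => sk; apply/negPn/negP => ev.
set m := #|porbit s x| in ev.
have m0 : (0 < m)%N by apply/card_gt0P; exists x; exact: porbit_id.
have m1 : (1 < m)%N by case: m ev m0 => [|[|]].
have im j : iter (j * m) s x = x.
  by elim: j => // j IHj; rewrite mulSn iterD IHj iter_porbit.
have r : iter (k.*2 %% m) s x = s x.
  by rewrite -[RHS]sk {2}(divn_eq k.*2 m) addnC iterD im.
have km : (k.*2 %% m < m)%N by rewrite ltn_mod.
have := nth_uniq x (i := k.*2 %% m) (j := 1) _ _ (uniq_traject_porbit s x).
rewrite -/m size_traject => /(_ km m1).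
rewrite !nth_traject//= r eqxx => /esym/eqP e1.
have : odd (k.*2 %% m) by rewrite e1.
have -> : odd (k.*2 %% m) = odd k.*2.
  by rewrite {2}(divn_eq k.*2 m) oddD oddM (negbTE ev) andbF.
by rewrite odd_double.
Qed.

(* A component with [v ~ g v] is unique, its black vertices form an odd orbit
   of [v |-> mate (g v)], and the other black vertices are paired off by the
   same map: the number of black vertices would be odd. *)
Lemma free_matching_aut_im A : perfect_matching A -> free (A :|: aut_im A).
Proof.
move=> pmA; set U := _ :|: _; have iU : invariant U := @invariant_setU_aut_im A.
have pmB := perfect_matching_aut_im pmA.
(* [t] preserves colors, and its square is the mate rotation of [A] and [aut_im A]. *)
pose t := (gV * mate_perm bip pmA)%g.
have tE v : t v = mate black A (gV v) by rewrite permM mate_permE.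
have tb v : black (t v) = black v by rewrite tE mate_black// g_swap negbK.
have tcon v : connect (adj U) (gV v) (t v).
  by rewrite tE; exact/connect_setU1/mate_adj.
have rE v : mate_rotation bip pmA pmB v = t (t v).
  by rewrite mate_rotationE !tE -mate_aut_im// gVK.
have rX i v : (mate_rotation bip pmA pmB ^+ i)%g v = (t ^+ i.*2)%g v.
  elim: i => [|i IHi]; first by rewrite !expg0.
  by rewrite expgSr permM IHi rE doubleS !expgSr !permM.
suff H v : black v -> ~~ connect (adj U) v (gV v).
  move=> v; have [/H//|bv] := boolP (black v).
  apply/negP => /(connect_aut iU); apply/negP/H.
  by rewrite g_swap.
move=> bv; apply/negP => vgv.
(* [t v] lies in the component of [v] and has its color, so a power of the rotation, that is an even
   power of [t], sends [v] to [t v]. *)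
have [i tvE] := porbitP _ _ _
  (connect_porbit bip pmA pmB (connect_trans vgv (tcon v)) (tb v)).
have oddO : odd #|porbit t v| by apply: (@odd_porbit _ _ _ i); rewrite -rX.
have sOb : porbit t v \subset [set u | black u].
  apply/fintype.subsetP => _ /porbitP[j ->]; rewrite inE.
  by elim: j => [|j IHj]; rewrite ?expg0 ?perm1// expgSr permM tb.
pose D := [set u | black u] :\: porbit t v.
have Dt u : (t u \in D) = (u \in D).
  rewrite !inE tb -!eq_porbit_mem; congr (~~ _ && _).
  by rewrite -[in RHS](porbit_perm t 1 u) expg1.
(* Otherwise [u] would lie in the component of [v], hence in its rotation orbit, which is part of
   its orbit under [t]. *)
have Dfree u : u \in D -> ~~ connect (adj U) u (gV u).
  rewrite !inE => /andP[uO bu]; apply/negP => ugu.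
  have := connect_porbit bip pmA pmB (components_meet iU vgv ugu).
  rewrite bu bv => /(_ erefl) /porbitP[j uE].
  by case/negP: uO; rewrite uE rX mem_porbit.
have Dside u : u \in D -> side U (t u) = ~~ side U u.
  by move=> uD; rewrite -(side_connect iU (tcon u)) side_swap// Dfree.
have cD : #|D :&: [set u | side U u]| = #|D :\: [set u | side U u]|.
  rewrite -(card_imset _ (@perm_inj _ t)); apply: eq_card => u.
  rewrite !inE; apply/imsetP/idP => [[w + ->]|uD].
    rewrite !inE => /andP[wD ws]; have wD' : w \in D by rewrite !inE.
    by have := Dt w; rewrite wD' Dside// ws !inE.
  exists ((t^-1)%g u); last by rewrite permKV.
  have uD' : u \in D by case/andP: uD => _; rewrite !inE.
  have tD : (t^-1)%g u \in D by rewrite -Dt permKV.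
  rewrite inE tD inE /=; apply/negPn.
  by rewrite -Dside// permKV; case/andP: uD.
have := cardsID (porbit t v) [set u | black u]; rewrite (finset.setIidPr sOb) card_black.
rewrite -/D -(cardsID [set u | side U u] D) cD addnn => /(congr1 odd).
by rewrite oddD oddO odd_double mul2n odd_double.
Qed.

(** An edge of [A] from [v] to [g v] would connect them in [A], which equals [A :|: aut_im A]. *)
Lemma mate_neq_aut A v : perfect_matching A -> invariant A -> gV v != mate black A v.
Proof.
move=> pmA /invariantP iA; apply/negP => /eqP gv.
have /negP[] := free_matching_aut_im pmA v.
by rewrite iA finset.setUid gv; apply/connect1/mate_adj.
Qed.

(** [g] commutes with both mates. On a symmetric component, descent on the exponent of the rotation
    reaches 0 or 1, where [g] sends a vertex to its mate in [A] or in [B]; [mate_neq_aut] forbids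
    both. *)
Lemma free_invariant_matchings A B : perfect_matching A -> perfect_matching B ->
  invariant A -> invariant B -> free (A :|: B).
Proof.
move=> pmA pmB iA iB v; apply/negP => vgv.
have gA w : gV (mate black A w) = mate black A (gV w).
  by rewrite -mate_aut_im// (invariantP _).1.
have gB w : gV (mate black B w) = mate black B (gV w).
  by rewrite -mate_aut_im// (invariantP _).1.
pose r := mate_rotation bip pmA pmB.
have [i rv] : exists i, mate black A (gV v) = (r ^+ i)%g v.
  apply/porbitP/connect_porbit; last by rewrite mate_black// g_swap negbK.
  exact/(connect_trans vgv)/connect_setU1/mate_adj.
(* Conjugating by the rotation lowers the exponent by 2. *)
elim/ltn_ind: i v {vgv} rv => -[|[|i]] IH v rv.
- have := mate_neq_aut v pmA iA; rewrite -[X in X != _](mateK bip pmA).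
  by rewrite rv expg0 perm1 eqxx.
- have := mate_neq_aut v pmB iB; rewrite -[X in X != _](mateK bip pmA).
  by rewrite rv expg1 mate_rotationE mateK// eqxx.
- apply: (IH i _ (r v)); first by [].
  rewrite mate_rotationE gA gB mateK//.
  apply: (@perm_inj _ r); rewrite {1}/r mate_rotationE mateK// rv.
  have powE (s : {perm vertex Z}) x : (s ^+ i.+2)%g x = s ((s ^+ i)%g (s x)).
    by rewrite expgSr permM expgS permM.
  by rewrite powE -(mate_rotationE bip pmA pmB v).
Qed.

(** * Exchanging two matchings on one component of each pair *)

Definition edge_side (U : {set edge Z}) e : bool := [exists v in ends e, side U v].

Definition mix (U A B : {set edge Z}) : {set edge Z} :=
  [set e | if edge_side U e then e \in A else e \in B].

Lemma edge_sideE U e v : invariant U -> e \in U -> v \in ends e ->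
  edge_side U e = side U v.
Proof.
move=> iU eU ve; apply/exists_inP/idP => [[w we]|sv]; last by exists v.
by rewrite (side_connect iU (connect_ends eU we ve)).
Qed.

Lemma edge_side_swap U e : invariant U -> free U -> e \in U ->
  edge_side U (gE e) = ~~ edge_side U e.
Proof.
move=> iU fU eU; have /andP[/card_gt0P[v ve] _] := ends_card e.
rewrite (edge_sideE iU eU ve) (@edge_sideE _ _ (gV v)) ?side_swap ?iU ?in_aut_ends//.
Qed.

(** Since the union is unchanged, a second mixing refers to the same sides and can undo the
    first. *)
Lemma mixU A B U : mix U A B :|: mix U B A = A :|: B.
Proof. by apply/setP => e; rewrite !inE; case: ifP => // _; rewrite orbC. Qed.

Lemma mixK A B U : mix U (mix U A B) (mix U B A) = A.
Proof. by apply/setP => e; rewrite !inE; case: ifP => // ->. Qed.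

Section Mix.
Variables A B : {set edge Z}.
Hypotheses (iU : invariant (A :|: B)) (fU : free (A :|: B)).
Local Notation U := (A :|: B).

(** All edges of [U] at [v] are on the side of [v], so around [v] the mix coincides with [A] or with
    [B]. *)
Lemma perfect_matching_mix : perfect_matching A -> perfect_matching B ->
  perfect_matching (mix U A B).
Proof.
move=> /forallP pmA /forallP pmB; apply/forallP => v.
have -> : [set e in mix U A B | v \in ends e] =
    [set e in if side U v then A else B | v \in ends e].
  apply/setP => e; rewrite !inE; apply: andb_id2r => ve.
  have [eU|] := boolP (e \in U).
    by rewrite (edge_sideE iU eU ve); case: ifP.
  rewrite !inE negb_or => /andP[/negbTE eA /negbTE eB].
  by case: (edge_side _ _); case: (side _ _); rewrite ?eA ?eB.
by case: ifP.
Qed.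

(** [g] exchanges the sides, hence also the roles of the two matchings. *)
Lemma aut_im_mix : aut_im (mix U A B) = mix U (aut_im B) (aut_im A).
Proof.
apply/setP => e; rewrite !inE; have [eU|eU] := boolP (e \in U).
  by rewrite edge_side_swap// if_neg.
have := eU; rewrite -iU !inE negb_or => /andP[/negbTE -> /negbTE ->].
by rewrite !if_same.
Qed.

End Mix.

Definition invariant_matchings : {set {set edge Z}} :=
  [set N | perfect_matching N & aut_im N == N].

Definition mix_pair (N : {set edge Z} * {set edge Z}) := mix (N.1 :|: N.2) N.1 N.2.

(** For a perfect matching [M], applying [g] exchanges both the two matchings and the two sides,
    which makes both results invariant. *)
Definition unmix (M : {set edge Z}) :=
  (mix (M :|: aut_im M) M (aut_im M), mix (M :|: aut_im M) (aut_im M) M).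

(** The image under [g] of the mix is the mix in the opposite order, so [unmix] sees the same union
    and the same sides. *)
Lemma mix_pairP N : N \in finset.setX invariant_matchings invariant_matchings ->
  perfect_matching (mix_pair N) /\ unmix (mix_pair N) = N.
Proof.
case: N => N1 N2; rewrite !inE /= => /andP[/andP[pm1 /eqP i1] /andP[pm2 /eqP i2]].
have iU : invariant (N1 :|: N2) by apply: invariant_setU; apply/invariantP.
have fU : free (N1 :|: N2) by apply: free_invariant_matchings => //; apply/invariantP.
split; first exact: perfect_matching_mix.
by rewrite /unmix /mix_pair/= aut_im_mix// i1 i2 mixU !mixK.
Qed.

Lemma unmixP M : perfect_matching M ->
  unmix M \in finset.setX invariant_matchings invariant_matchings /\ mix_pair (unmix M) = M.
Proof.
move=> pmM; have pmgM := perfect_matching_aut_im pmM.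
have iU := @invariant_setU_aut_im M; have fU := free_matching_aut_im pmM.
split; last by rewrite /mix_pair/= mixU mixK.
have sC := finset.setUC M (aut_im M).
rewrite !inE /= perfect_matching_mix//= aut_im_mix// aut_imK eqxx /=.
have pm2 := @perfect_matching_mix (aut_im M) M.
have im2 := @aut_im_mix (aut_im M) M.
by rewrite -sC aut_imK in pm2 im2; rewrite pm2//= im2.
Qed.

Lemma card_perfect_matchings :
  #|[set M : {set edge Z} | perfect_matching M]| = (#|invariant_matchings| ^ 2)%N.
Proof.
rewrite -mulnn -cardsX; apply/eqP; rewrite eqn_leq; apply/andP; split.
  have inj : {in [set M | perfect_matching M] &, injective unmix}.
    by apply: (can_in_inj (g := mix_pair)) => M; rewrite inE => /unmixP[].
  rewrite -(card_in_imset inj); apply/subset_leq_card/fintype.subsetP => _ /imsetP[M + ->].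
  by rewrite inE => /unmixP[].
have inj : {in finset.setX invariant_matchings invariant_matchings &, injective mix_pair}.
  by apply: (can_in_inj (g := unmix)) => N /mix_pairP[].
rewrite -(card_in_imset inj); apply/subset_leq_card/fintype.subsetP => _ /imsetP[N + ->].
by rewrite inE => /mix_pairP[].
Qed.

(** * Perfect matchings of the quotient graph and their lifts *)

Lemma porbit_involutive (T : finType) (s : {perm T}) x y : involutive s ->
  (y \in porbit s x) = (y == x) || (y == s x).
Proof.
move=> sK; apply/porbitP/orP => [[i ->]|[/eqP->|/eqP->]].
- rewrite permX -[i]odd_double_half -mul2n mulnC iterD iterM.
  have -> : iter i./2 (iter 2 s) x = x by elim: i./2 => //= k ->; rewrite sK.
  by case: (odd i); [right|left].
- by exists 0; rewrite expg0 perm1.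
- by exists 1; rewrite expg1.
Qed.

Lemma porbit_in_porbits (T : finType) (s : {perm T}) x : porbit s x \in porbits s.
Proof. exact: imset_f. Qed.

Definition vertex_class v : quotient_vertex g :=
  exist _ (porbit gV v) (porbit_in_porbits gV v).

Definition edge_class e : quotient_edge g :=
  exist _ (porbit gE e) (porbit_in_porbits gE e).

Lemma vertex_class_surj B : exists v, B = vertex_class v.
Proof. by have /imsetP[v _ vE] := valP B; exists v; apply: val_inj. Qed.

Lemma edge_class_surj A : exists e, A = edge_class e.
Proof. by have /imsetP[e _ eE] := valP A; exists e; apply: val_inj. Qed.

Lemma edge_class_aut e : edge_class (gE e) = edge_class e.
Proof.
apply: val_inj => /=; apply/eqP.
by rewrite eq_porbit_mem porbit_involutive// eqxx orbT.
Qed.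

Lemma edge_class_eq e f : edge_class e = edge_class f -> e = f \/ e = gE f.
Proof.
move=> /(congr1 val)/= /eqP; rewrite eq_porbit_mem porbit_involutive//.
by case/orP => /eqP; [left|right].
Qed.

Lemma quotient_endsE v e : (vertex_class v \in ends (g := quotient_graph g) (edge_class e)) =
  (v \in ends e) || (v \in ends (gE e)).
Proof.
rewrite /= inE; apply/exists_inP/orP => [[f]|ve].
  rewrite /= porbit_involutive// => /orP[]/eqP-> /exists_inP[u];
    rewrite porbit_involutive// => /orP[]/eqP-> ue.
  - by left.
  - by right; rewrite in_ends_aut.
  - by right.
  - by left; rewrite -in_aut_ends.
by case: ve => ve; [exists e|exists (gE e)];
  rewrite ?porbit_involutive ?eqxx ?orbT//; apply/exists_inP; exists v;
  rewrite ?porbit_id.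
Qed.

(** An edge and its image both contain [v] when their class is a loop at the class of [v]; hence
    uniqueness is only asked of classes. *)
Lemma quotient_matchingP (N : {set edge (quotient_graph g)}) :
  perfect_matching N <->
  forall v, exists2 e, edge_class e \in N /\ v \in ends e &
    forall f, edge_class f \in N -> v \in ends f -> edge_class f = edge_class e.
Proof.
split=> [/perfect_matchingP pmN v|pmN].
  have [A [AN vA] AU] := pmN (vertex_class v); have [e eA] := edge_class_surj A.
  subst A; move: vA; rewrite quotient_endsE => ve.
  have U f : edge_class f \in N -> v \in ends f -> edge_class f = edge_class e.
    by move=> fN vf; apply: AU => //; rewrite quotient_endsE vf.
  case/orP: ve => ve; [exists e|exists (gE e)] => //; first by rewrite edge_class_aut.
  by rewrite edge_class_aut.
apply/perfect_matchingP => B; have [v ->] := vertex_class_surj B.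
have [e [eN ve] eU] := pmN v.
exists (edge_class e); first by rewrite quotient_endsE ve.
move=> A; have [f ->] := edge_class_surj A => fN.
rewrite quotient_endsE => /orP[]vf; first exact: eU.
by rewrite -edge_class_aut; apply: eU => //; rewrite edge_class_aut.
Qed.

Definition lift_matching (N : {set edge (quotient_graph g)}) : {set edge Z} :=
  [set e | edge_class e \in N].

Lemma lift_matching_inj : injective lift_matching.
Proof.
move=> N N' NE; apply/setP => A; have [e ->] := edge_class_surj A.
by have /setP/(_ e) := NE; rewrite !inE.
Qed.

(* If both preimages of an edge of [N] joined [v] to [g v], keeping only one of
   them would give a perfect matching contradicting [free_matching_aut_im]. *)
Lemma lift_matching_perfect N : perfect_matching N -> perfect_matching (lift_matching N).
Proof.
move=> /quotient_matchingP pmN.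
(* A [loop] joins some [v] to [g v], so its class is a loop of the quotient. [first] selects one
   edge of each class, also when [gE e = e]. *)
pose loop e := [exists v in ends e, gV v \in ends e].
pose first e := (enum_rank e <= enum_rank (gE e))%N.
pose M := [set e | (edge_class e \in N) && (loop e ==> first e)].
have loopP e v : loop e -> v \in ends e -> v \in ends (gE e).
  move=> /exists_inP[u ue gue] ve; rewrite in_ends_aut.
  have [bu|bu] := boolP (black v == black u).
    by rewrite (ends_black bip ve ue (eqP bu)).
  have -> : v = gV u; last by rewrite gVK.
  apply: (ends_black bip ve gue); rewrite g_swap.
  by move: bu; case: (black v) (black u) => -[].
have loop_aut e : loop (gE e) = loop e.
  suff sub f : loop f -> loop (gE f).
    by apply/idP/idP => [/sub|/sub//]; rewrite gEK.
  move=> lf; have /exists_inP[u uf guf] := lf.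
  by apply/exists_inP; exists u; apply: loopP.
have pmM : perfect_matching M.
  apply/perfect_matchingP => v; have [e [eN ve] eU] := pmN v.
  have [le|le] := boolP (loop e); last first.
    exists e; first by rewrite inE eN (negbTE le).
    move=> f; rewrite inE => /andP[fN _] vf.
    case: (edge_class_eq (eU f fN vf)) => // fE; case/negP: le.
    by apply/exists_inP; exists v => //; rewrite -in_ends_aut -fE.
  have [e0 [e0N ve0 le0 fe0] e0U] : exists2 e0,
      [/\ edge_class e0 \in N, v \in ends e0, loop e0 & first e0] &
      edge_class e0 = edge_class e.
    have [fe|fe] := leqP (enum_rank e) (enum_rank (gE e)); first by exists e.
    exists (gE e); last exact: edge_class_aut.
    by rewrite edge_class_aut eN loopP// loop_aut le /first gEK (ltnW fe).
  exists e0; first by rewrite inE e0N le0 fe0.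
  move=> f; rewrite inE => /andP[fN lf] vf.
  have := eU f fN vf; rewrite -e0U => /edge_class_eq[//|fE].
  move: lf; rewrite fE loop_aut le0 /= /first gEK => ff.
  apply: enum_rank_inj; apply/ord_inj/eqP; rewrite eqn_leq ff; exact: fe0.
have noloop e : edge_class e \in N -> ~~ loop e.
  move=> eN; apply/negP => le; have [f fM lf] : exists2 f, f \in M & loop f.
    have [fe|fe] := leqP (enum_rank e) (enum_rank (gE e)).
      by exists e; rewrite // inE eN /first fe implybT.
    exists (gE e); last by rewrite loop_aut.
    by rewrite inE edge_class_aut eN /first gEK (ltnW fe) implybT.
  have /exists_inP[v vf gvf] := lf.
  have /negP[] := free_matching_aut_im pmM v.
  by apply/connect_setU1/adjP; exists f.
suff <- : M = lift_matching N by [].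
apply/setP => e; rewrite !inE; case: (boolP (_ \in N)) => // eN.
by rewrite (negbTE (noloop e eN)).
Qed.

(** Lifts are invariant and perfect, and an invariant perfect matching is the lift of the set of
    classes of its edges. *)
Lemma card_invariant_matchings :
  #|invariant_matchings| = num_perfect_matchings (quotient_graph g).
Proof.
rewrite /num_perfect_matchings -(card_imset _ lift_matching_inj).
apply: eq_card => M; rewrite inE; apply/andP/imsetP => [[pmM /eqP gM]|[N + ->]].
  exists [set A | [exists e in M, A == edge_class e]].
    rewrite inE; apply/quotient_matchingP => v.
    have [e [eM ve] eU] := perfect_matchingP _ pmM v.
    exists e; first by rewrite inE; split => //; apply/exists_inP; exists e.
    move=> f; rewrite inE => /exists_inP[h hM /eqP fh] vf.
    rewrite (eU f _ vf)//; case: (edge_class_eq fh) => -> //.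
    by rewrite -gM inE gEK.
  apply/setP => e; rewrite !inE; apply/idP/exists_inP => [eM|[f fM /eqP]].
    by exists e.
  by case/edge_class_eq => -> //; rewrite -gM inE gEK.
rewrite inE => /lift_matching_perfect ->; split => //.
by apply/eqP/setP => e; rewrite !inE edge_class_aut.
Qed.

End Symmetry.

Theorem theorem6 (R : realType) (Z : graph) (n : nat)
    (emb : sphere_embedding R Z)
    (black : vertex Z -> bool) (black_bip : bipartition black)
    (card_Z : #|vertex Z| = (4 * n)%N)
    (g : automorphism Z) (g_antipodal : antipodal_action emb g)
    (g_swap : forall v : vertex Z, black (aut_vertex g v) = ~~ black v) :
  num_perfect_matchings Z = (num_perfect_matchings (quotient_graph g) ^ 2)%N.
Proof.
have gVK := aut_vertexK g_antipodal; have gEK := aut_edgeK g_antipodal.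
have meet U : invariant g U -> forall v w,
    connect (adj U) v (aut_vertex g v) -> connect (adj U) w (aut_vertex g w) ->
    connect (adj U) v w.
  by move=> iU v w; exact: (antipodal_components_meet g_antipodal iU).
rewrite -(card_invariant_matchings black_bip card_Z g_swap gVK gEK meet).
exact: (card_perfect_matchings black_bip card_Z g_swap gVK gEK meet).
Qed.
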